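(* Let $G$ be a countably infinite group with identity $e$ such that for each $g\in G\setminus\{e\}$ the set $\{x\in G:x^2=g\}$ is finite. Then there exists a subset $A\subseteq G$ such that $A\supsetneq\Delta(A)\supsetneq\Delta^2(A)\supsetneq\Delta^3(A)\supsetneq\cdots$.
   Context: For $A\subseteq G$, $\Delta(A)=\{g\in G:|gA\cap A|=\infty\}$, and $\Delta^{k+1}(A)=\Delta(\Delta^k(A))$ with $\Delta^1=\Delta$. *)

(* Defs.v *)
From mathcomp Require Import all_boot.
From mathcomp Require Import boolp classical_sets functions cardinality.

Set Implicit Arguments.
Unset Strict Implicit.
Unset Printing Implicit Defensive.

Local Open Scope classical_set_scope.
Local Open Scope group_scope.

(* [groupType] is the class of arbitrary, possibly infinite, groups. *)

Definition translate (G : groupType) (g : G) (A : set G) : set G :=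
  [set g * a | a in A].

Definition Delta (G : groupType) (A : set G) : set G :=
  [set g | infinite_set (translate g A `&` A)].

(* The exponent counts applications of [Delta], so [Delta_iter 0 A] is [A]. *)
Definition Delta_iter (G : groupType) (k : nat) (A : set G) : set G :=
  iter k (@Delta G) A.

(* Main.v *)
(* The set [A] is built in stages, each new element receiving a finite level.
   Writing [level k] for the set of elements of level at least [k], with [1] in
   all of them, the aim is [Delta (level k) = level k.+1] for every [k], so that
   [A = level 0] works.  A stage takes some [g] already in [level n.+1] and adds
   [x], [g * x] and their inverses with level [n], for an [x] so generic that the
   quotients involving a new element are [1], [g], [g^-1] or outside a prescribed
   finite set, which exhausts [G] as the stages proceed.  Finiteness of the sets
   of square roots makes such an [x] exist: it keeps words such as [x * x],
   [x * g * x] and [g * x * x] away from a finite set. *)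
Require Import Defs.
From mathcomp Require Import all_boot.
From mathcomp Require Import boolp classical_sets functions cardinality.

Set Implicit Arguments.
Unset Strict Implicit.
Unset Printing Implicit Defensive.

Local Open Scope classical_set_scope.
Local Open Scope card_scope.
Local Open Scope group_scope.

(** * Generic elements from the finiteness of square roots *)

Section Fresh.
Variable G : groupType.

Definition new_elements (g x : G) : seq G := [:: x; x^-1; g * x; (g * x)^-1].

(** Products serve as quotients, since [new_elements g x] and the lists [F] of interest are closed
    under inversion. The first clause treats a new element against an old one, the second two new
    ones. *)
Definition fresh (g : G) (F : seq G) (x : G) : Prop :=
  (forall a b, a \in new_elements g x -> b \in F -> a * b \notin F) /\
  (forall a b, a \in new_elements g x -> b \in new_elements g x ->
    a * b \in F -> a * b \in [:: 1; g; g^-1]).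

Lemma new_elementsV (g x a : G) :
  a \in new_elements g x -> a^-1 \in new_elements g x.
Proof.
rewrite !inE => /or4P[] /eqP->; rewrite ?invgK eqxx ?orbT //.
Qed.

(* If the centralizer of [g] is infinite we take [x] inside it; otherwise
   [x^-1 g x = h] has finitely many solutions for each [h]. *)
Lemma exists_avoiding (g : G) (E : set G) (F : seq G) :
  infinite_set [set: G] -> finite_set E ->
  exists x, [/\ ~ E x, ~ E (g * x) & g ^ x \in F -> g ^ x = g].
Proof.
move=> Ginf Efin; pose E' := E `|` [set g^-1 * y | y in E].
have E'fin : finite_set E' by rewrite finite_setU; split=> //; apply: finite_image.
have avoidE x : ~ E' x -> ~ E x /\ ~ E (g * x).
  move=> E'x; split=> Ex; apply: E'x; [by left|].
  by right; exists (g * x) => //; rewrite mulKg.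
have [Cfin|Cinf] := pselect (finite_set [set x | g ^ x = g]); last first.
  have [x [/= gx E'x]] := infinite_setN0 (infinite_setD Cinf E'fin).
  by have [? ?] := avoidE _ E'x; exists x.
have Sfin h : finite_set [set x | g ^ x = h].
  have [[x0 /= gx0]|noS] := pselect (exists x0, g ^ x0 = h); last first.
    apply: (@sub_finite_set _ _ set0) (finite_set0 _) => x /= gx.
    by apply: noS; exists x.
  apply: sub_finite_set (finite_image (fun y => y * x0) Cfin) => x /= gx.
  by exists (x / x0); rewrite ?mulgVK //= conjgM gx -gx0 conjgK.
have SFfin : finite_set [set x | g ^ x \in F].
  rewrite (_ : [set x | _] = \bigcup_(h in [set` F]) [set x | g ^ x = h]).
    exact: bigcup_finite (finite_seq F) _.
  by apply/seteqP; split=> [x /= Fx|x [h /= Fh ->]//]; exists (g ^ x).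
have Bfin : finite_set (E' `|` [set x | g ^ x \in F]) by rewrite finite_setU.
have [x [_ /= /not_orP[E'x Fx]]] := infinite_setN0 (infinite_setD Ginf Bfin).
by have [? ?] := avoidE _ E'x; exists x; split.
Qed.

(** Up to inversion, a product of two new elements is [1], [g], the conjugate [g ^ x], or one of
    [x * x], [g * x * (g * x)], [g * x * x], [x * (g * x)]; the last four are controlled by the
    squares of [x] and [g * x]. *)
Lemma exists_fresh (g : G) (F : seq G) :
  infinite_set [set: G] ->
  (forall h : G, h <> 1 -> finite_set [set x : G | x ^+ 2 = h]) ->
  (forall y, y \in F -> y^-1 \in F) ->
  exists x, fresh g F x.
Proof.
move=> Ginf sqrt_fin FV.
pose K := [seq c / b | c <- F, b <- F].
(* The translates are there because [g * x * x = h] means [x * x = g^-1 * h], and [x * (g * x) = h]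
   means [g * x * (g * x) = g * h]. *)
pose S := F ++ [seq g^-1 * h | h <- F] ++ [seq g * h | h <- F].
pose R := \bigcup_(h in [set h | h \in S /\ h <> 1]) [set x : G | x ^+ 2 = h].
have Rfin : finite_set R.
  apply: bigcup_finite => [|h [_ /sqrt_fin//]].
  by apply: sub_finite_set (finite_seq S) => h [].
have Efin : finite_set ([set` K] `|` R).
  by rewrite finite_setU; split=> //; apply: finite_seq.
have [x [/not_orP[Kx Rx] /not_orP[Kgx Rgx] gxF]] :=
  exists_avoiding g F Ginf Efin.
(* Once the relevant square is [1], the word [g * x * x] collapses to [g] and [x * (g * x)] to
   [g^-1], both allowed values. *)
have sqP y : ~ R y -> y * y \in S -> y * y = 1.
  move=> Ry Sy; apply: contra_notP Ry => y1.
  by exists (y * y) => //; rewrite /= expg2.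
have {Rx} x2 := sqP x Rx; have {Rgx} gx2 := sqP (g * x) Rgx.
have KP y a b : ~ [set` K] y -> b \in F -> a \in F -> y <> a / b.
  by move=> Ky Fb Fa ye; apply: Ky; rewrite /= ye; apply: allpairs_f.
exists x; split=> [a b aN Fb|].
  apply/negP => Fab.
  move: aN Fab; rewrite !inE => /or4P[] /eqP-> Fab.
  - by apply: (KP _ _ _ Kx Fb Fab); rewrite mulgK.
  - by apply: (KP _ _ _ Kx Fab Fb); rewrite invgM invgK mulVKg.
  - by apply: (KP _ _ _ Kgx Fb Fab); rewrite mulgK.
  - by apply: (KP _ _ _ Kgx Fab Fb); rewrite [_^-1]invgM invgK mulVKg.
pose ok w := w \in F -> w \in [:: 1; g; g^-1].
have okV w : ok w -> ok w^-1.
  rewrite /ok => okw /FV; rewrite invgK => /okw.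
  by rewrite !inE => /or3P[] /eqP->; rewrite ?invg1 ?invgK eqxx ?orbT.
have ok1 : ok 1 by rewrite /ok !inE eqxx.
have okg : ok g by rewrite /ok !inE eqxx ?orbT.
have okxx : ok (x * x).
  by move=> Fw; rewrite x2 ?inE ?eqxx // mem_cat Fw.
have okgxgx : ok (g * x * (g * x)).
  by move=> Fw; rewrite gx2 ?inE ?eqxx // mem_cat Fw.
have okgxx : ok (g * x * x).
  move=> Fw; have: x * x = 1.
    apply: x2; rewrite !mem_cat; apply/or3P/Or32/mapP.
    by exists (g * x * x) => //; rewrite -mulgA mulKg.
  by rewrite -mulgA => ->; rewrite mulg1 !inE eqxx orbT.
have okxgx : ok (x * (g * x)).
  move=> Fw; have: g * x * (g * x) = 1.
    apply: gx2; rewrite !mem_cat; apply/or3P/Or33/mapP.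
    by exists (x * (g * x)) => //; rewrite -mulgA.
  by rewrite -mulgA => /mulg1_eq <-; rewrite !inE eqxx !orbT.
have okJ : ok (x^-1 * (g * x)).
  by move=> /gxF; rewrite conjgE => ->; rewrite !inE eqxx orbT.
move=> a b aN bN; rewrite -/(ok _); move: aN bN.
rewrite !inE => /or4P[] /eqP-> /or4P[] /eqP->; rewrite ?mulgV ?mulVg ?mulgK //.
- by rewrite [(g * x)^-1]invgM mulVKg; apply: okV.
- by rewrite -invgM; apply: okV.
- by rewrite -invgM; apply: okV.
- by have := okV _ okJ; rewrite invgM invgK.
- by rewrite -invgM; apply: okV.
- by rewrite -invgM; apply: okV.
Qed.
End Fresh.

(** * The staged construction and its levels *)

Section Construction.
Variables (G : groupType) (e : nat -> G) (pick : G -> seq G -> G).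
Hypothesis e_surj : forall g, exists i, e i = g.
Hypothesis pickP : forall g F,
  (forall y, y \in F -> y^-1 \in F) -> fresh g F (pick g F).

(* A state lists the elements chosen so far, each with its level; the identity
   counts as an element of every level. *)
Definition level_ge (P : seq (G * nat)) (k : nat) (y : G) : bool :=
  (y == 1) || has (fun p => (p.1 == y) && (k <= p.2)) P.

(** The [e i] make every element of [G] forbidden from some stage on. Inverses are adjoined to meet
    the premise of [pickP], and [1] so that new elements themselves lie outside the list. *)
Definition forbidden (s : nat) (P : seq (G * nat)) : seq G :=
  let U := 1 :: [seq p.1 | p <- P] ++ [seq e i | i <- iota 0 s] in
  U ++ [seq y^-1 | y <- U].

(* Every pair [(e i, n)] is the task of infinitely many stages, namely of
   [2 ^ i * 3 ^ n * 5 ^ m] for all [m]. *)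
Definition task_elt (s : nat) : G := e (logn 2 s).
Definition task_level (s : nat) : nat := logn 3 s.

Definition fresh_elt (s : nat) (P : seq (G * nat)) : G :=
  pick (task_elt s) (forbidden s P).

Definition step (s : nat) (P : seq (G * nat)) : seq (G * nat) :=
  if level_ge P (task_level s).+1 (task_elt s) then
    [seq (y, task_level s) | y <- new_elements (task_elt s) (fresh_elt s P)] ++ P
  else P.

Fixpoint state (s : nat) : seq (G * nat) :=
  if s is t.+1 then step t (state t) else [::].

Definition active (s : nat) : bool :=
  level_ge (state s) (task_level s).+1 (task_elt s).

Definition added (s : nat) : seq G :=
  new_elements (task_elt s) (fresh_elt s (state s)).

Definition level (k : nat) : set G :=
  [set y | exists s, level_ge (state s) k y].

Lemma task_recurrent (g : G) (n N : nat) :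
  exists s, [/\ N <= s, task_elt s = g & task_level s = n].
Proof.
have [i <-] := e_surj g; exists (2 ^ i * (3 ^ n * 5 ^ N))%N; split.
- apply: leq_trans (ltnW (ltn_expl N (isT : 1 < 5))) _.
  by rewrite mulnA leq_pmull // muln_gt0 !expn_gt0.
- by rewrite /task_elt !lognM ?muln_gt0 ?expn_gt0 // !lognX /= muln1 !muln0 !addn0.
- by rewrite /task_level !lognM ?muln_gt0 ?expn_gt0 // !lognX /= muln1 !muln0 addn0.
Qed.

Lemma level_ge_le P j k y : j <= k -> level_ge P k y -> level_ge P j y.
Proof.
move=> jk /orP[y1|/hasP[p Pp /andP[py kp]]]; apply/orP; first by left.
by right; apply/hasP; exists p => //; rewrite py (leq_trans jk).
Qed.

Lemma level_ge_step s k y :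
  level_ge (state s.+1) k y =
  level_ge (state s) k y || [&& active s, k <= task_level s & y \in added s].
Proof.
rewrite /= /step -/(active s); case: (active s); last by rewrite orbF.
rewrite /level_ge has_cat /= orbCA orbC; congr (_ || _).
by rewrite !inE !(eq_sym y); case: (k <= _); rewrite ?andbT ?andbF ?orbF.
Qed.

Lemma level_ge_mono s t k y :
  s <= t -> level_ge (state s) k y -> level_ge (state t) k y.
Proof.
move=> /subnK <-; elim: (t - s)%N => // d IH sy.
by rewrite addSn level_ge_step IH.
Qed.

Lemma level_geV s k y : level_ge (state s) k y -> level_ge (state s) k y^-1.
Proof.
elim: s => [|s IH]; first by rewrite /level_ge !orbF invg_eq1.
rewrite !level_ge_step => /orP[/IH->//|/and3P[-> -> yN]].
by rewrite new_elementsV ?orbT.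
Qed.

Lemma level_sub j k : j <= k -> level k `<=` level j.
Proof. by move=> jk y [s sy]; exists s; apply: level_ge_le sy. Qed.

Lemma level1 k : level k 1.
Proof. by exists 0; rewrite /level_ge eqxx. Qed.

Lemma levelV k y : level k y -> level k y^-1.
Proof. by move=> [s /level_geV sy]; exists s. Qed.

Lemma forbiddenV s P y : y \in forbidden s P -> y^-1 \in forbidden s P.
Proof.
rewrite /forbidden; set U := _ :: _; rewrite !mem_cat => /orP[Uy|].
  by rewrite map_f ?orbT.
by move=> /mapP[z Uz ->]; rewrite invgK Uz.
Qed.

Lemma forbidden_enum i s P : i < s -> e i \in forbidden s P.
Proof.
move=> si; rewrite /forbidden mem_cat in_cons mem_cat.
by rewrite [e i \in [seq e i | i <- _]]map_f ?orbT // mem_iota.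
Qed.

Lemma forbidden_level_ge s k y :
  level_ge (state s) k y -> y \in forbidden s (state s).
Proof.
move=> /orP[/eqP->|/hasP[p Pp /andP[/eqP<- _]]]; rewrite mem_cat in_cons ?eqxx //.
by rewrite mem_cat (map_f fst Pp) orbT.
Qed.

Lemma addedP s : fresh (task_elt s) (forbidden s (state s)) (fresh_elt s (state s)).
Proof. by apply: pickP => y; apply: forbiddenV. Qed.

Lemma added_notin_forbidden s y : y \in added s -> y \notin forbidden s (state s).
Proof.
have [aP _] := addedP s => yN; rewrite -[y]mulg1; apply: aP => //.
by rewrite mem_cat mem_head.
Qed.

(** A stage with task [(1, k)] is always active, and its [x] enters with level [k]. Being new it had
    no level before, and being forbidden afterwards it is never added again with a higher one. *)
Lemma level_proper k : level k.+1 `<` level k.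
Proof.
split; first exact: level_sub.
have [s [_ s1 sk]] := task_recurrent 1 k 0.
pose x := fresh_elt s (state s).
have xN : x \in added s by rewrite mem_head.
have act : active s by rewrite /active s1 /level_ge eqxx.
have sx : level_ge (state s.+1) k x by rewrite level_ge_step act sk leqnn xN orbT.
move=> /(_ x) [|t]; first by exists s.+1.
have old : level_ge (state s) k.+1 x -> False.
  by move=> /forbidden_level_ge; apply/negP/added_notin_forbidden.
have [ts|st] := leqP t s; first by move=> /(level_ge_mono ts).
rewrite -(subnK st); elim: (t - s.+1)%N => [|d IH].
  by rewrite add0n level_ge_step sk ltnn andbF orbF.
rewrite addSn level_ge_step => /orP[/IH//|/and3P[_ _ /added_notin_forbidden/negP]].
by apply; apply: forbidden_level_ge (level_ge_mono (leq_addl _ _) sx).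
Qed.

(* From stage [s0] on, [h] is among the forbidden elements, so a new pair of
   elements with quotient [h] forces [h] to be the element of the current task
   or its inverse, which has level above [k]. *)
Lemma level_Delta_sub k : Delta (level k) `<=` level k.+1.
Proof.
move=> h /=; apply: contra_notP => hk.
have [s0 es0] := e_surj h.
have late s : s0 < s -> h \in forbidden s (state s).
  by rewrite -es0; apply: forbidden_enum.
apply: (@sub_finite_set _ _ [set a | a \in forbidden s0.+1 (state s0.+1)]);
  last exact: finite_seq.
move=> a [[b [sb sbP] ab] [sa saP]] /=.
apply: (@forbidden_level_ge _ k).
move: (level_ge_mono (leq_maxl sa sb) saP) (level_ge_mono (leq_maxr sa sb) sbP).
move: (maxn sa sb) => s {sa saP sb sbP}.
have hE : h = a * b^-1 by rewrite -ab mulgK.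
(* Induction on a stage [s] where [a] and [b] both have level at least [k] traces [a] back to stage
   [s0.+1]. At later stages [oldP] excludes one old and one new element, and [newP] leaves only [h]
   in [1], [g], [g^-1], against [hk]. *)
elim: s => [|s IH]; first by move=> sa _; apply: level_ge_mono sa.
have [ss0|s0s] := leqP s s0.
  by move=> sa _; apply: level_ge_mono sa.
have Fh := late _ s0s.
have [oldP newP] := addedP s.
have Finv := @forbiddenV s (state s).
rewrite 2!level_ge_step => /orP[a_old|/and3P[act kn aN]] /orP[b_old|/and3P[_ _ bN]].
- exact: IH.
- have := oldP b a^-1 bN (Finv _ (forbidden_level_ge a_old)).
  by rewrite -[_ * _]invgK invgM invgK -hE Finv.
- have := oldP _ b^-1 aN (Finv _ (forbidden_level_ge b_old)).
  by rewrite -hE Fh.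
- have := newP _ _ aN (new_elementsV bN); rewrite -hE => /(_ Fh) hN.
  have gk : level k.+1 (task_elt s) by exists s; apply: level_ge_le act.
  case: hk; move: hN; rewrite !inE => /or3P[] /eqP->.
  + exact: level1.
  + exact: gk.
  + exact: levelV.
Qed.

(** A finite intersection would be wholly forbidden at all late stages. But a late stage with task
    [(g, k)] is active and puts the new, hence not forbidden, element [g * x] into the
    intersection. *)
Lemma level_sub_Delta k : level k.+1 `<=` Delta (level k).
Proof.
move=> g [t tg] /= fin.
have [s [ts sg sk N_s]] : exists s, [/\ t <= s, task_elt s = g, task_level s = k &
    translate g (level k) `&` level k `<=` [set` forbidden s (state s)]].
  have [N N_bound] : exists N, forall s, N <= s ->
      translate g (level k) `&` level k `<=` [set` forbidden s (state s)].
    have /finite_seqP[r ->] := fin.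
    elim: r {fin} => [|y r [N IH]]; first by exists 0.
    have [i ei] := e_surj y; exists (maxn N i.+1) => s.
    rewrite geq_max => /andP[Ns si] z; rewrite /= in_cons => /orP[/eqP->|].
      by rewrite -ei; apply: forbidden_enum.
    exact: IH.
  have [s [Ns sg sk]] := task_recurrent g k (maxn t N).
  move: Ns; rewrite geq_max => /andP[ts Ns].
  by exists s; split=> //; apply: N_bound.
have act : active s by rewrite /active sg sk (level_ge_mono ts).
pose x := fresh_elt s (state s).
have addedk y : y \in added s -> level k y.
  by move=> yN; exists s.+1; rewrite level_ge_step act sk leqnn yN orbT.
have xN : x \in added s by rewrite mem_head.
have gxN : g * x \in added s by rewrite -sg !inE eqxx !orbT.
have /negP := added_notin_forbidden gxN; apply; apply: N_s.
by split; [exists x => //|]; apply: addedk.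
Qed.

Lemma Delta_iter_level k : Delta_iter k (level 0) = level k.
Proof.
elim: k => //= k ->; apply/seteqP; split.
  exact: level_Delta_sub.
exact: level_sub_Delta.
Qed.

End Construction.

Theorem theorem5p4 (G : groupType)
  (G_countably_infinite : [set: G] #= [set: nat])
  (finite_square_roots :
     forall g : G, g <> 1 -> finite_set [set x : G | x ^+ 2 = g]) :
  exists A : set G,
    forall k : nat, Delta_iter k.+1 A `<` Delta_iter k A.
Proof.
have Ginf : infinite_set [set: G].
  by rewrite (eq_finite_set G_countably_infinite); apply: infinite_nat.
have [e e_surj] : exists e : nat -> G, forall g, exists i, e i = g.
  have /card_set_bijP[f [_ f_inj f_surj]] := G_countably_infinite.
  have /choice[e fe] : forall i, exists g, f g = i.
    by move=> i; have [g _ <-] := f_surj i I; exists g.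
  by exists e => g; exists (f g); apply: f_inj; rewrite ?inE.
have /choice[pick pickP] : forall gF : G * seq G, exists x,
    (forall y, y \in gF.2 -> y^-1 \in gF.2) -> fresh gF.1 gF.2 x.
  move=> [g F]; have [FV|nFV] := pselect (forall y, y \in F -> y^-1 \in F).
    by have [x ?] := exists_fresh g Ginf finite_square_roots FV; exists x.
  (* Default value for lists not closed under inversion, where the required implication is
     vacuous. *)
  by exists 1.
exists (level e (fun g F => pick (g, F)) 0) => k.
have pickP' g F := pickP (g, F).
rewrite !(Delta_iter_level e_surj pickP').
exact: level_proper.
Qed.
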